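(* Let $(X,\mathcal{F})$ be a generic dynamical system. Then the following are equivalent: (i) The system $(X,\mathcal{F})$ is minimal. (ii) For every opene set $U\subset X$ and every point $x\in X$, there exist $n\in\mathbb{N}$ and $f_1,f_2,\dots,f_n\in\mathcal{F}$ such that $f_n\circ f_{n-1}\circ\cdots\circ f_1(x)\in U$. (iii) For every $x\in X$, the orbit $O_{\mathcal{F}}(x)$ is dense in $X$. (iv) The set $Trans(\mathcal{F})$ of all transitive points is equal to the entire space $X$. (v) For every opene set $U\subset X$, $\bigcup_{n\in\mathbb{N},\ f_1,\dots,f_n\in\mathcal{F}} f_1^{-1}\circ f_2^{-1}\circ\cdots\circ f_n^{-1}(U)=X$. (vi) For every opene set $U\subset X$, there exists a finite subset $\mathcal{G}\subset\mathcal{F}$ such that $\bigcup_{n\in\mathbb{N},\ g_1,\dots,g_n\in\mathcal{G}} g_1^{-1}\circ g_2^{-1}\circ\cdots\circ g_n^{-1}(U)=X$. (vii) If $A\subset X$ is nonempty, closed and $+$ invariant, then $A=X$.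
   Context: $\mathbb{N}=\{1,2,3,\dots\}$. A generic dynamical system (GDS) is a pair $(X,\mathcal{F})$ where $X$ is a compact metric space and $\mathcal{F}$ is a collection of continuous maps $X\to X$. ''Opene'' means nonempty and open. The maps $f^{-1}$ denote preimage operations, so $f_1^{-1}\circ\cdots\circ f_n^{-1}(U)=(f_n\circ\cdots\circ f_1)^{-1}(U)$. The orbit of $x\in X$ is $O_{\mathcal{F}}(x)=\{f_n\circ\cdots\circ f_1(x): n\in\mathbb{N},\ f_1,\dots,f_n\in\mathcal{F}\}$. A point is transitive if its orbit is dense in $X$; $Trans(\mathcal{F})$ is the set of transitive points. A subset $A\subset X$ is $+$ invariant if $\mathcal{F}(A):=\bigcup_{f\in\mathcal{F}}f(A)\subset A$. $(X,\mathcal{F})$ is minimal if there is no proper, nonempty, closed, $+$ invariant subset of $X$.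
   Formalization: The collection of maps F is assumed nonempty; for F empty and X a single point, (i) and (vii) hold while (ii)–(vi) fail. *)

(* Defs.v *)
From HB Require Import structures.
From mathcomp Require Import all_boot all_order all_algebra.
From mathcomp Require Import all_classical all_reals all_analysis.

Set Implicit Arguments.
Unset Strict Implicit.
Unset Printing Implicit Defensive.

Local Open Scope classical_set_scope.

(* A finite sequence f_1, ..., f_n of maps is encoded by n and a function
   f : nat -> X -> X of which only the first n values matter, with f i standing
   for f_(i+1). *)
Definition words (X : Type) (F : set (X -> X)) (n : nat) : set (nat -> X -> X) :=
  [set f | forall i, (i < n)%N -> F (f i)].

(* f_n \o ... \o f_1 *)
Fixpoint compn (X : Type) (f : nat -> X -> X) (n : nat) : X -> X :=
  if n is m.+1 then f m \o compn f m else id.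

(* f_1^-1 (f_2^-1 (... (f_n^-1 U))) *)
Fixpoint preimn (X : Type) (f : nat -> X -> X) (n : nat) (U : set X) : set X :=
  if n is m.+1 then preimn f m (f m @^-1` U) else U.

(* The identity is not included: n ranges over positive integers. *)
Definition gds_orbit (X : Type) (F : set (X -> X)) (x : X) : set X :=
  [set y | exists n f, [/\ (0 < n)%N, words F n f & y = compn f n x]].

Definition preimages (X : Type) (F : set (X -> X)) (U : set X) : set X :=
  \bigcup_(n in [set n | (0 < n)%N]) \bigcup_(f in words F n) preimn f n U.

Definition opene (X : topologicalType) (U : set X) : Prop :=
  open U /\ U !=set0.

Definition transitive_points (X : topologicalType) (F : set (X -> X)) : set X :=
  [set x | dense (gds_orbit F x)].

Definition plus_invariant (X : Type) (F : set (X -> X)) (A : set X) : Prop :=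
  \bigcup_(f in F) (f @` A) `<=` A.

Definition minimal_system (X : topologicalType) (F : set (X -> X)) : Prop :=
  ~ exists A : set X,
      [/\ A `<` [set: X], A !=set0, closed A & plus_invariant F A].

(* Main.v *)
(* The closure of an orbit is nonempty, closed and + invariant, so minimality
   makes every orbit dense. Conversely, a proper, nonempty, closed, + invariant
   set has an opene complement that no orbit starting inside it can reach.
   Finitely many maps suffice in (vi) because [X] is covered by finitely many of
   the open preimages of [U]. *)
Require Import Defs.
From HB Require Import structures.
From mathcomp Require Import all_boot all_order all_algebra finmap.
From mathcomp Require Import all_classical all_reals all_analysis.

Local Open Scope classical_set_scope.

Section Words.
Set Implicit Arguments.
Unset Strict Implicit.
Context {X : Type}.
Implicit Types (F : set (X -> X)) (f : nat -> X -> X) (A U : set X).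

Lemma preimnE f n U : preimn f n U = compn f n @^-1` U.
Proof. by elim: n U => //= n IHn U; rewrite IHn. Qed.

Lemma preimagesP F U x :
  preimages F U x <->
  exists n f, [/\ (0 < n)%N, words F n f & U (compn f n x)].
Proof.
split=> [[n n0 [f Ff]]|[n [f [n0 Ff Ux]]]].
  by rewrite preimnE => Ux; exists n, f.
by exists n => //; exists f => //; rewrite preimnE.
Qed.

(** This allows a word to be altered beyond its first [n] letters. *)
Lemma eq_compn f g n :
  (forall i, (i < n)%N -> f i = g i) -> compn f n =1 compn g n.
Proof.
elim: n => //= n IHn fg x; rewrite (fg n (ltnSn n)); congr (g n _).
by apply: IHn => i ilt; apply: fg; exact: ltnW.
Qed.

Lemma plus_invariant_compn F A f n x :
  plus_invariant F A -> words F n f -> A x -> A (compn f n x).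
Proof.
move=> FA; elim: n => //= n IHn Ff Ax; apply: FA; exists (f n); first exact: Ff.
by exists (compn f n x) => //; apply: IHn => // i ilt; apply: Ff; exact: ltnW.
Qed.

Lemma gds_orbit_plus_invariant F x : plus_invariant F (gds_orbit F x).
Proof.
move=> _ [g Fg [_ [n [f [n0 Ff ->]]] <-]].
(* Appending [g] at index [n] lengthens the word by one letter; the values past [n] are
   irrelevant. *)
exists n.+1, (fun i => if (i < n)%N then f i else g); split=> //=.
  by move=> i _; case: ifPn => [/Ff|].
rewrite ltnn; congr g; apply: eq_compn => i ilt.
by rewrite ilt.
Qed.

(** Words have positive length, so an empty [F] would make every orbit empty: on a one-point space,
    (i) would hold and (ii) would fail. *)
Lemma gds_orbit_neq0 F x : F !=set0 -> gds_orbit F x !=set0.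
Proof. by move=> [g Fg]; exists (g x), 1%N, (fun=> g); split=> // i. Qed.

End Words.

Section Topology.
Set Implicit Arguments.
Unset Strict Implicit.
Context {X : topologicalType}.
Implicit Types (F : set (X -> X)) (f : nat -> X -> X) (A U : set X).

Lemma continuous_compn F f n :
  (forall g, F g -> continuous g) -> words F n f -> continuous (compn f n).
Proof.
move=> Fcont; elim: n => [_ x|n IHn Ff x] /=; first exact: cvg_id.
apply: (@continuous_comp _ _ _ (compn f n) (f n)).
  by apply: IHn => i ilt; apply: Ff; exact: ltnW.
exact/Fcont/Ff.
Qed.

(** By continuity, the preimage under [g] of a neighbourhood of [g x] is a neighbourhood of [x],
    hence meets [A] at a point that [g] keeps in [A]. *)
Lemma closure_plus_invariant F A :
  (forall g, F g -> continuous g) ->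
  plus_invariant F A -> plus_invariant F (closure A).
Proof.
move=> Fcont FA _ [g Fg [x Ax <-]] B Bgx.
have [y [Ay By]] := Ax _ (Fcont g Fg x B Bgx).
by exists (g y); split=> //; apply: FA; exists g => //; exists y.
Qed.

(* [compact_cover] is only stated for pointed spaces; a point of [A] will do. *)
Lemma compact_cover_compact A : compact A -> cover_compact A.
Proof.
have [->|/set0P[a Aa]] := eqVneq A set0.
  by move=> _ I D V _ _; exists fset0 => // x.
pose Xa : ptopologicalType := HB.pack X (isPointed.Build X a).
by rewrite -[cover_compact A]/(@cover_compact Xa A) -compact_cover.
Qed.

(* A finite subcover of the preimages of [U] uses only finitely many words, and
   [G] collects their letters. *)
Lemma preimages_finite F U :
  compact [set: X] -> (forall g, F g -> continuous g) -> open U ->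
  preimages F U = [set: X] ->
  exists G, [/\ G `<=` F, finite_set G & preimages G U = [set: X]].
Proof.
move=> /compact_cover_compact Xcompact Fcont oU FU.
(* Each [x] gets a word, paired with its length, that sends it into [U]. *)
have /choice[w wP] (x : X) : exists w : nat * (nat -> X -> X),
    [/\ (0 < w.1)%N, words F w.1 w.2 & U (compn w.2 w.1 x)].
  have /preimagesP[n [f nfP]] : preimages F U x by rewrite FU.
  by exists (n, f).
pose V x := compn (w x).2 (w x).1 @^-1` U.
have [|x _|D _ DV] := Xcompact _ [set: X] V.
- move=> x _; apply: open_comp => // y _.
  by have [_ wF _] := wP x; exact: (continuous_compn Fcont wF).
- by exists x => //; have [] := wP x.
exists (\bigcup_(x in [set` D]) (w x).2 @` `I_((w x).1)); split.
- by move=> _ [x _ [i ilt <-]]; have [_ wF _] := wP x; exact: wF.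
- by apply: bigcup_finite => // x _; exact/finite_image/finite_II.
(* The word chosen for [x] sends all of [V x] into [U], so it also serves [y]. *)
- apply/seteqP; split=> // y _; have [x Dx Vy] := DV y I.
  have [w0 _ _] := wP x; apply/preimagesP; exists (w x).1, (w x).2; split=> //.
  by move=> i ilt; exists x => //; exists i.
Qed.

End Topology.

Theorem theorem4p5 (R : realType) (X : metricType R) (F : set (X -> X))
    (Xcompact : compact [set: X])
    (Fneq0 : F !=set0)
    (Fcont : forall f : X -> X, F f -> continuous f) :
  [<-> (* (i) *) minimal_system F;
       (* (ii) *) forall (U : set X) (x : X), opene U ->
         exists (n : nat) (f : nat -> X -> X),
           [/\ (0 < n)%N, words F n f & U (compn f n x)];
       (* (iii) *) forall x : X, dense (gds_orbit F x);
       (* (iv) *) transitive_points F = [set: X];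
       (* (v) *) forall U : set X, opene U -> preimages F U = [set: X];
       (* (vi) *) forall U : set X, opene U ->
         exists G : set (X -> X),
           [/\ G `<=` F, finite_set G & preimages G U = [set: X]];
       (* (vii) *) forall A : set X,
         A !=set0 -> closed A -> plus_invariant F A -> A = [set: X]].
Proof.
(* The implications form a cycle: each condition gives the next, and (vii) gives (i). *)
tfae.
- move=> Fmin U x [oU U0].
  have orbT : closure (gds_orbit F x) = [set: X].
    apply: contrapT => orbNT; apply: Fmin; exists (closure (gds_orbit F x)).
    split.
    + by rewrite properEneq; split=> //; exact/eqP.
    + have [y Oy] := gds_orbit_neq0 x Fneq0.
      by exists y; exact: subset_closure.
    + exact: closed_closure.
    + exact/closure_plus_invariant/gds_orbit_plus_invariant.
  have [y Uy] := U0; have : closure (gds_orbit F x) y by rewrite orbT.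
  move=> /(_ U (open_nbhs_nbhs (conj oU Uy)))[_ [[n [f [n0 Ff ->]]] Ufx]].
  by exists n, f.
- move=> hit x U U0 oU; have [n [f [n0 Ff Ufx]]] := hit U x (conj oU U0).
  by exists (compn f n x); split=> //; exists n, f.
- by move=> Odense; apply/seteqP; split=> // x _; exact: Odense.
- move=> transT U [oU U0]; apply/seteqP; split=> // x _.
  have : transitive_points F x by rewrite transT.
  move=> /(_ U U0 oU)[y [Uy [n [f [n0 Ff yE]]]]]; rewrite yE in Uy.
  by apply/preimagesP; exists n, f.
- by move=> FU U Uopene; apply: preimages_finite (FU U Uopene) => //; case: Uopene.
- move=> FU A [a Aa] cA FA; apply: contrapT => ANT.
  have [|G [GF _ GU]] := FU (~` A).
    split; first exact: closed_openC.
    by apply/set0P; apply: contra_notN ANT => /eqP AC0; rewrite -[A]setCK AC0 setC0.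
  (* A word over [G] takes [a] out of [A], yet it is also a word over [F], which cannot leave
     [A]. *)
  have /preimagesP[n [f [_ Gf]]] : preimages G (~` A) a by rewrite GU.
  by apply; apply: plus_invariant_compn FA _ Aa => i /Gf /GF.
- by move=> AT [A [AproperT A0 cA FA]]; move: AproperT; rewrite (AT A)// => /properxx.
Qed.
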